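(* Let $L$ be a nonempty continuous dcpo. Then the following are equivalent: (a) for every compact core-compact topological space $X$, the Isbell topology and the Scott topology on $C(X,L)$ coincide, i.e. $\operatorname{Is}(C(X,L))=\sigma(C(X,L))$; (b) $L$ is conditionally bounded complete.
   Context: Directed sets are nonempty. A dcpo is a poset in which every directed subset has a supremum. For $u,x$ in a dcpo $P$, $u\ll x$ means that whenever $D\subseteq P$ is directed and $x\le\sup D$, some $d\in D$ satisfies $u\le d$. $P$ is continuous if for every $x\in P$ the set $\{u:u\ll x\}$ is directed with supremum $x$. $P$ is conditionally bounded complete if every nonempty subset having an upper bound has a supremum. A subset of a dcpo $P$ is Scott open if it is upward closed and inaccessible by directed suprema; $\sigma(P)$ is the topology of Scott-open sets. For a topological space $X$, $\mathcal O(X)$ is its lattice of open sets ordered by inclusion; $X$ is core compact if $\mathcal O(X)$ is a continuous dcpo. Compactness means every open cover has a finite subcover (no separation axiom). $C(X,L)$ is the set of continuous maps from $X$ to $(L,\sigma(L))$, ordered pointwise; it is a dcpo with directed suprema computed pointwise, and $\sigma(C(X,L))$ is its Scott topology. The Isbell topology $\operatorname{Is}(C(X,L))$ is generated (as a subbase) by the sets $[\mathcal H,V]=\{f\in C(X,L):f^{-1}(V)\in\mathcal H\}$, where $\mathcal H\subseteq\mathcal O(X)$ is Scott open in $\mathcal O(X)$ and $V\in\sigma(L)$. *)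

(* Defs.v *)
From HB Require Import structures.
From mathcomp Require Import all_boot all_order.
From mathcomp Require Import mathcomp_extra boolp classical_sets topology.

Set Implicit Arguments.
Unset Strict Implicit.
Unset Printing Implicit Defensive.

Import Order.TTheory.

Local Open Scope classical_set_scope.
Local Open Scope order_scope.

Section domains.
Context {d : Order.disp_t} {P : porderType d}.
Implicit Types (D A U : set P) (x y z u s : P).

Definition directed D :=
  D !=set0 /\
  forall x y, D x -> D y -> exists2 z, D z & x <= z /\ y <= z.

Definition way_below u x :=
  forall D s, directed D -> isLub D s -> x <= s -> exists2 y, D y & u <= y.

Definition scott_open U :=
  (forall x y, U x -> x <= y -> U y) /\
  (forall D s, directed D -> isLub D s -> U s -> exists2 y, D y & U y).

End domains.

Definition dcpo d (P : porderType d) :=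
  forall D : set P, directed D -> exists s, isLub D s.

Definition continuous_dcpo d (P : porderType d) :=
  dcpo P /\
  forall x : P, let B := [set u | way_below u x] in directed B /\ isLub B x.

Definition conditionally_bounded_complete d (P : porderType d) :=
  forall A : set P, A !=set0 -> has_ubound A -> exists s, isLub A s.

(* [scott P] is the poset [P] equipped with its Scott topology. *)
Definition scott d (P : porderType d) : Type := P.

Section scott_topology.
Context {d : Order.disp_t} {P : porderType d}.

Let scott_openT : scott_open [set: P].
Proof. by split=> // D s [[y Dy] _] _ _; exists y. Qed.

Let scott_openI (U V : set P) :
  scott_open U -> scott_open V -> scott_open (U `&` V).
Proof.
move=> [upU inU] [upV inV]; split=> [x y [Ux Vx] xy|D s dD Ds [Us Vs]].
  by split; [exact: upU xy|exact: upV xy].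
have [x Dx Ux] := inU _ _ dD Ds Us; have [y Dy Vy] := inV _ _ dD Ds Vs.
have [z Dz [xz yz]] := dD.2 _ _ Dx Dy.
by exists z => //; split; [exact: upU xz|exact: upV yz].
Qed.

Let scott_open_bigU (I : Type) (f : I -> set P) :
  (forall i, scott_open (f i)) -> scott_open (\bigcup_i f i).
Proof.
move=> fo; split=> [x y [i _ fix_] xy|D s dD Ds [i _ fis]].
  by exists i => //; exact: (fo i).1 xy.
by have [y Dy fiy] := (fo i).2 _ _ dD Ds fis; exists y => //; exists i.
Qed.

HB.instance Definition _ := Order.POrder.on (scott P).
HB.instance Definition _ := isOpenTopological.Build (scott P)
  scott_openT scott_openI scott_open_bigU.

Lemma scott_openE : @open (scott P) = @scott_open d P.
Proof. by []. Qed.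

End scott_topology.

Record opens (X : topologicalType) :=
  Opens { opens_set :> set X ; _ : opens_set \in open }.

Fact opens_display : Order.disp_t. Proof. exact: Order.Disp tt tt. Qed.

HB.instance Definition _ (X : topologicalType) := [isSub for @opens_set X].
HB.instance Definition _ (X : topologicalType) :=
  [Choice of opens X by <:].
HB.instance Definition _ (X : topologicalType) :=
  [SubChoice_isSubPOrder of opens X by <: with opens_display].

Lemma opens_leE (X : topologicalType) (U V : opens X) :
  (U <= V) = (U `<=` V) :> Prop.
Proof. by rewrite -Order.le_val subsetEset. Qed.

Definition core_compact (X : topologicalType) := continuous_dcpo (opens X).

Definition contmap (X : topologicalType) d (L : porderType d) : Type :=
  continuousType X (scott L).

Fact contmap_display : Order.disp_t. Proof. exact: Order.Disp tt tt. Qed.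

Section contmap.
Context {X : topologicalType} {d : Order.disp_t} {L : porderType d}.

HB.instance Definition _ := Choice.on (contmap X L).

Definition contmap_fun (f : contmap X L) : X -> scott L :=
  (f : continuousType X (scott L)).

Coercion contmap_fun : contmap >-> Funclass.

Definition contmap_le (f g : contmap X L) : bool :=
  `[< forall x, f x <= g x >].

Let contmap_le_refl : reflexive contmap_le.
Proof. by move=> f; apply/asboolP. Qed.

Let contmap_le_anti : antisymmetric contmap_le.
Proof.
move=> f g /andP[/asboolP fg /asboolP gf]; apply/continuousEP => x.
by apply/le_anti; rewrite [X in X && _]fg [X in _ && X]gf.
Qed.

Let contmap_le_trans : transitive contmap_le.
Proof.
move=> g f h /asboolP fg /asboolP gh; apply/asboolP => x.
exact: le_trans (fg x) (gh x).
Qed.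

HB.instance Definition _ := Order.Le_isPOrder.Build contmap_display
  (contmap X L) contmap_le_refl contmap_le_anti contmap_le_trans.

Lemma contmap_leE (f g : contmap X L) :
  (f <= g) = (forall x, f x <= g x) :> Prop.
Proof. by apply/propext; split=> /asboolP. Qed.

Fact contmap_preimage_open (f : contmap X L) (V : opens (scott L)) :
  f @^-1` V \in open.
Proof.
apply/mem_set; apply: open_comp; last exact: set_mem (valP V).
move=> x _; exact: (@cts_fun X (scott L) f x).
Qed.

Definition contmap_preimage (f : contmap X L) (V : opens (scott L)) : opens X :=
  Opens (contmap_preimage_open f V).

Definition isbell_subbasic (H : set (opens X)) (V : opens (scott L)) :
    set (contmap X L) :=
  [set f | H (contmap_preimage f V)].

Definition isbell_subbase : set (set (contmap X L)) :=
  [set W | exists (H : set (opens X)) (V : opens (scott L)),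
    scott_open H /\ W = isbell_subbasic H V].

End contmap.

(* [isbell X L] is [contmap X L] equipped with the Isbell topology. *)
Definition isbell (X : topologicalType) d (L : porderType d) : Type :=
  contmap X L.

Section isbell.
Context {X : topologicalType} {d : Order.disp_t} {L : porderType d}.

HB.instance Definition _ := Order.POrder.on (isbell X L).
HB.instance Definition _ := isSubBaseTopological.Build (isbell X L)
  (@isbell_subbase X d L) id.

Lemma isbell_openE :
  @open (isbell X L) =
  [set \bigcup_(W in F) W
    | F in subset^~ (finI_from (@isbell_subbase X d L) id)].
Proof. by []. Qed.

End isbell.

(* Main.v *)
Require Import Defs.
From HB Require Import structures.
From mathcomp Require Import all_boot all_order.
From mathcomp Require Import mathcomp_extra boolp classical_sets topology.
From mathcomp Require Import cardinality wochoice finmap.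

(** The Isbell topology is always coarser than the Scott topology, because
directed suprema of maps are pointwise ([isbell_open_scott_open]).

From (b) to (a), let W be a Scott open set of maps and f in W.  Cover X by
finitely many open sets U_i, each way below the preimage of the points way above
some u_i; this is where compactness of X is used.  On X the step map that takes
at x the supremum of the u_i with x in U_i is defined: the set of these u_i is
nonempty since the U_i cover X, and f x bounds it.  Such step maps form a
directed family with supremum f, so one of them, g, is in W; and the maps h for
which every U_i is way below the preimage of the points way above u_i form an
Isbell neighbourhood of f that lies above g ([scott_open_isbell_open]).

From (a) to (b), the test spaces are [two_ended I], a discrete set I with two
points at infinity, a neighbourhood of either being cofinite.  This space is
compact and core compact, but the two compact open sets obtained by removing one
of the points at infinity meet in the discrete set I.  A map with values E true
and E false at infinity may take on I arbitrary common upper bounds of the pair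
E.  For a map that is constant on I, an Isbell neighbourhood contains all maps
of this kind that agree with it on some finite subset of I; if Scott open sets
are Isbell open, the same holds for Scott neighbourhoods.  So (a) yields a
closure principle ([separation]): a set C of functions on I that is closed
downwards and under suitable directed suprema, and that meets every such set of
maps, contains the constant function.

Fix pairs E' and E with E' s way below E s for both s.  Two choices of C give
existence results.  With I the set of pairs of naturals, any two common upper
bounds of E have a lower bound that is a common upper bound of E'
([pair_lower_bound]).  With I the set of maps from a well-ordered set T to
booleans, and a diagonal argument along T, all common upper bounds of E together
have a lower bound that is a common upper bound of E' ([ub2_lower_bound]).
Letting E' approach E, these lower bounds form a directed set whose supremum is
the supremum of the pair E ([pair_sup]); suprema of nonempty bounded sets follow
by directed suprema of finite ones. *)

Set Implicit Arguments.
Unset Strict Implicit.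
Unset Printing Implicit Defensive.

Import Order.TTheory.

Local Open Scope order_scope.
Local Open Scope classical_set_scope.

(** * Continuous dcpos *)

Section Domains.
Context {d : Order.disp_t} {P : porderType d}.
Implicit Types (D A U : set P) (x y z u s : P).

Lemma directed1 x : directed [set x].
Proof. by split; [exists x|move=> _ _ -> ->; exists x]. Qed.

Lemma isLub1 x : isLub [set x] x.
Proof. by split=> [_ ->//|b]; apply. Qed.

Lemma isLub_unique A s t : isLub A s -> isLub A t -> s = t.
Proof. by move=> [us ls] [ut lt]; apply/le_anti; rewrite ls// lt. Qed.

Lemma way_below_le u x : way_below u x -> u <= x.
Proof. by move=> /(_ _ _ (directed1 x) (isLub1 x) (lexx x))[_ ->]. Qed.

Lemma way_below_trans u u' x x' :
  u' <= u -> way_below u x -> x <= x' -> way_below u' x'.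
Proof.
move=> u'u ux xx' D s dD Ds x's.
have [y Dy uy] := ux _ _ dD Ds (le_trans xx' x's).
by exists y => //; exact: le_trans uy.
Qed.

Lemma directed_image d' (Q : porderType d') (f : P -> Q) D :
  {homo f : x y / x <= y} -> directed D -> directed (f @` D).
Proof.
move=> f_homo [[x Dx] dD]; split; first by exists (f x), x.
move=> _ _ [y Dy <-] [z Dz <-]; have [w Dw [yw zw]] := dD _ _ Dy Dz.
by exists (f w); [exists w|split; exact: f_homo].
Qed.

Hypothesis P_cont : continuous_dcpo P.

(** The elements way below some element that is itself way below x form a
directed set with supremum x, so u lies below one of them. *)
Lemma way_below_interpolate u x :
  way_below u x -> exists2 y, way_below u y & way_below y x.
Proof.
move=> ux; have [dBx lBx] := P_cont.2 x.
pose D := [set w | exists2 y, way_below y x & way_below w y].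
have dD : directed D.
  split.
    have [y yx] := dBx.1; have [w wy] := (P_cont.2 y).1.1.
    by exists w, y.
  move=> w w' [y yx wy] [y' y'x w'y'].
  have [z zx [yz y'z]] := dBx.2 _ _ yx y'x.
  have [v vz [wv w'v]] := (P_cont.2 z).1.2 w w'
    (way_below_trans (lexx _) wy yz) (way_below_trans (lexx _) w'y' y'z).
  by exists v => //; exists z.
have lD : isLub D x.
  split=> [w [y /way_below_le yx /way_below_le wy]|b ub].
    exact: le_trans yx.
  apply: lBx.2 => y yx; apply: (P_cont.2 y).2.2 => w wy.
  by apply: ub; exists y.
have [w [y yx wy] uw] := ux _ _ dD lD (lexx x).
by exists y => //; exact: way_below_trans uw wy (lexx y).
Qed.

Lemma scott_open_way_above u : scott_open [set x | way_below u x].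
Proof.
split=> [x y ux xy|D s dD Ds us]; first exact: way_below_trans ux xy.
have [y uy ys] := way_below_interpolate us.
have [z Dz yz] := ys _ _ dD Ds (lexx s).
by exists z => //; exact: way_below_trans uy yz.
Qed.

Lemma way_below_upper u u' x :
  way_below u x -> way_below u' x ->
  exists2 v, way_below v x & u <= v /\ u' <= v.
Proof. exact: (P_cont.2 x).1.2. Qed.

End Domains.

(** * Open sets and maps as dcpos *)

Section Opens.
Context {X : topologicalType}.
Implicit Types (D : set (opens X)) (U V : opens X).

Lemma opens_open U : open U.
Proof. exact: set_mem (valP U). Qed.

Definition open_set (A : set X) (oA : open A) : opens X := Opens (mem_set oA).

Lemma opens_inj U V : (U : set X) = V -> U = V.
Proof. exact: val_inj. Qed.

Fact opens_cup_open D : open (\bigcup_(U in D) (U : set X)).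
Proof. by apply: bigcup_open => U _; exact: opens_open. Qed.

Definition opens_cup D : opens X := open_set (@opens_cup_open D).

Lemma isLub_opens_cup D : isLub D (opens_cup D).
Proof.
split=> [U DU|V ubV]; rewrite opens_leE; first exact: bigcup_sup.
by apply: bigcup_sub => U DU; rewrite -opens_leE; exact: ubV.
Qed.

Lemma isLub_opens D U : isLub D U -> (U : set X) = \bigcup_(V in D) (V : set X).
Proof. by move=> /isLub_unique /(_ (isLub_opens_cup D)) ->. Qed.

Lemma opens_dcpo : dcpo (opens X).
Proof. by move=> D _; exists (opens_cup D); exact: isLub_opens_cup. Qed.

End Opens.

Section Maps.
Context {X : topologicalType} {d : Order.disp_t} {L : porderType d}.

Lemma contmap_preimageP (g : contmap X L) (V : set L) :
  scott_open V -> open (g @^-1` V).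
Proof.
by move=> oV; exact: (opens_open (contmap_preimage g (@open_set (scott L) V oV))).
Qed.

Lemma contmap_of (f : X -> L) :
  (forall V : set L, scott_open V -> open (f @^-1` V)) ->
  exists g : contmap X L, g = f :> (X -> L).
Proof.
move=> f_open; have fc : continuous (f : X -> scott L) by apply/continuousP.
by exists (mkcts fc : continuousType X (scott L)).
Qed.

Hypothesis L_dcpo : dcpo L.

(** The pointwise supremum t of a directed family of maps is continuous, since
the preimage under t of a Scott open set is the union of the preimages under the
members of the family; hence t is the supremum among maps. *)
Lemma contmap_lub (D : set (contmap X L)) (s : contmap X L) :
  directed D -> isLub D s ->
  forall x, isLub [set (contmap_fun g x : L) | g in D] (s x).
Proof.
move=> dD Ds.
have eval_homo x : {homo (fun g : contmap X L => g x : L) : g h / g <= h}.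
  by move=> g h; rewrite contmap_leE.
have ex x := L_dcpo (directed_image (eval_homo x) dD).
have [t tE] := choice ex.
have [t' t'E] : exists g : contmap X L, g = t :> (X -> L).
  apply: contmap_of => V oV.
  suff -> : t @^-1` V = \bigcup_(g in D) ((g : contmap X L) @^-1` V).
    by apply: bigcup_open => g _; exact: contmap_preimageP.
  apply/seteqP; split=> [x Vtx|x [g Dg Vgx]] /=.
    have [_ [g Dg <-] Vgx] := oV.2 _ _ (directed_image (eval_homo x) dD) (tE x) Vtx.
    by exists g.
  by apply: oV.1 Vgx _; apply: (tE x).1; exists g.
suff -> : s = t' by move=> x; rewrite t'E.
apply: isLub_unique Ds _; split=> [g Dg|b ub]; rewrite contmap_leE => x.
  by rewrite t'E; apply: (tE x).1; exists g.
rewrite t'E; apply: (tE x).2 => _ [g Dg <-].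
by have := ub _ Dg; rewrite contmap_leE.
Qed.

(** Preimages of V turn a pointwise directed supremum of maps into a directed
union of open sets, and H is inaccessible by such unions. *)
Lemma isbell_subbasic_scott_open (H : set (opens X)) (V : opens (scott L)) :
  scott_open H -> scott_open (isbell_subbasic (L := L) H V).
Proof.
move=> [upH inH]; have oV : scott_open (V : set L) := opens_open V.
have pre_homo : {homo (fun g : contmap X L => contmap_preimage g V) :
    g h / g <= h}.
  move=> g h; rewrite contmap_leE opens_leE => gh x Vgx.
  exact: oV.1 Vgx (gh x).
split=> [g h Hg gh|D s dD Ds Hs]; first exact: upH Hg (pre_homo _ _ gh).
suff lub : isLub [set contmap_preimage g V | g in D] (contmap_preimage s V).
  by have [_ [g Dg <-]] := inH _ _ (directed_image pre_homo dD) lub Hs; exists g.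
suff -> : contmap_preimage s V = opens_cup [set contmap_preimage g V | g in D].
  exact: isLub_opens_cup.
apply: opens_inj; apply/seteqP; split=> [x Vsx|x [_ [g Dg <-]] Vgx].
  have dDx : directed [set (contmap_fun g x : L) | g in D].
    by apply: directed_image dD => g h; rewrite contmap_leE.
  have [_ [g Dg <-] Vgx] := oV.2 _ _ dDx (contmap_lub dD Ds x) Vsx.
  by exists (contmap_preimage g V) => //; exists g.
apply: oV.1 Vgx _; apply: (contmap_lub dD Ds x).1; by exists g.
Qed.

Lemma isbell_ind (Q : set (contmap X L) -> Prop) :
  Q setT -> (forall U V, Q U -> Q V -> Q (U `&` V)) ->
  (forall F : set (set (contmap X L)), F `<=` Q -> Q (\bigcup_(W in F) W)) ->
  (forall H V, scott_open H -> Q (isbell_subbasic H V)) ->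
  forall W, @open (isbell X L) W -> Q W.
Proof.
move=> QT QI QU Qsub _ [F sF <-]; apply: QU => W /sF[D' sD' <-].
rewrite bigcap_fset big_seq; apply: big_ind => // V VD'.
by have /set_mem[H [U [oH ->]]] := sD' V VD'; exact: Qsub.
Qed.

Lemma isbell_open_scott_open (W : set (contmap X L)) :
  @open (isbell X L) W -> scott_open W.
Proof.
move: W; apply: isbell_ind => [||F sF|H V oH].
- exact: (@openT (scott (contmap X L))).
- exact: (@openI (scott (contmap X L))).
- exact: (@bigcup_open (scott (contmap X L)) _ F id).
- exact: isbell_subbasic_scott_open.
Qed.

Lemma isbell_subbasic_open (H : set (opens X)) (V : opens (scott L)) :
  scott_open H -> @open (isbell X L) (isbell_subbasic H V).
Proof.
move=> oH; rewrite isbell_openE.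
exists [set isbell_subbasic H V]; last by rewrite bigcup_set1.
by move=> _ ->; apply: (@finI_from1 _ _ _ id); exists H, V.
Qed.

End Maps.

Definition above_opens d (L : porderType d) (L_cont : continuous_dcpo L) (u : L) :
    opens (scott L) :=
  @open_set (scott L) _ (scott_open_way_above L_cont u).

(** * Step maps and Isbell neighbourhoods *)

Section Approximation.
Context {X : topologicalType} {d : Order.disp_t} {L : porderType d}.
Hypotheses (X_compact : cover_compact [set: X]) (X_cc : core_compact X).
Hypotheses (L_cont : continuous_dcpo L) (L_cbc : conditionally_bounded_complete L).
Variable f : contmap X L.

Definition above_pre (u : L) : opens X := contmap_preimage f (above_opens L_cont u).

(** The condition that the open sets of F cover X makes [step_vals F x] nonempty,
so that suprema of nonempty bounded sets suffice to define the step map of F. *)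
Definition step_spec (F : seq (opens X * L)) :=
  (forall p, p \in F -> way_below p.1 (above_pre p.2)) /\
  (forall x : X, exists2 p, p \in F & (p.1 : set X) x).

Definition step_vals (F : seq (opens X * L)) (x : X) : set L :=
  [set u | exists2 U : opens X, (U, u) \in F & (U : set X) x].

Definition is_step (F : seq (opens X * L)) (g : contmap X L) :=
  forall x, isLub (step_vals F x) (g x).

Lemma step_vals_le F x u : step_spec F -> step_vals F x u -> u <= f x.
Proof.
move=> [F_wb _] [U /F_wb /= /way_below_le]; rewrite opens_leE => Uf /Uf.
exact: way_below_le.
Qed.

(** The step map is continuous because an open set containing x keeps containing
the points near x: the set of which the supremum is taken can only grow near
x. *)
Lemma step_exists F : step_spec F -> exists g, is_step F g.
Proof.
move=> FF; have ex x : exists t, isLub (step_vals F x) t.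
  apply: L_cbc; last by exists (f x) => u; exact: step_vals_le.
  by have [[U u] UF Ux] := FF.2 x; exists u, U.
have [t tE] := choice ex.
suff /contmap_of[g gE] : forall V : set L, scott_open V -> open (t @^-1` V).
  by exists g => x; rewrite gE.
move=> V oV; rewrite openE => x Vtx.
suff : \forall y \near x, forall p, p \in F -> (p.1 : set X) x -> (p.1 : set X) y.
  apply: filterS => y Fy; apply: oV.1 Vtx _; apply: (tE x).2 => u [U UF Ux].
  by apply: (tE y).1; exists U => //; exact: (Fy (U, u)).
elim: F {FF ex t tE V oV Vtx} => [|[U u] F IH]; first by apply: nearW.
have [Ux|nUx] := pselect ((U : set X) x).
  have : \forall y \near x, (U : set X) y.
    by apply: open_nbhs_nbhs; split => //; exact: opens_open.
  move: IH; apply: filterS2 => y Fy Uy p; rewrite inE => /predU1P[->//|pF].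
  exact: Fy.
move: IH; apply: filterS => y Fy p; rewrite inE => /predU1P[->//|pF].
exact: Fy.
Qed.

Lemma step_refine (U : opens X) (x : X) :
  (U : set X) x -> exists2 V : opens X, way_below V U & (V : set X) x.
Proof.
have [_ lU] := X_cc.2 U; rewrite (isLub_opens lU) => -[V VU Vx].
by exists V.
Qed.

(** Compactness of X extracts a finite cover from all pairs (U, u) with U way
below the preimage of the points way above u. *)
Lemma step_spec_exists : exists F, step_spec F.
Proof.
pose D := [set p : opens X * L | way_below p.1 (above_pre p.2)].
have [||F FD cF] := X_compact (I := (opens X * L)%type) (D := D)
  (f := fun p => (p.1 : set X)).
- by move=> p _; exact: opens_open.
- move=> x _; have [u ufx] := (L_cont.2 (f x)).1.1.
  have [V Vu Vx] := @step_refine (above_pre u) x ufx.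
  by exists (V, u).
exists (finmap.enum_fset F); split=> [p /FD/set_mem//|x].
by have [p pF px] := cF x I; exists p.
Qed.

Lemma step_cat F G : step_spec F ->
  (forall p, p \in G -> way_below p.1 (above_pre p.2)) -> step_spec (F ++ G).
Proof.
move=> [F1 F2] G1; split=> [p|x]; first by rewrite mem_cat => /orP[/F1|/G1].
by have [p pF px] := F2 x; exists p => //; rewrite mem_cat pF.
Qed.

Lemma step_le F G g h : {subset F <= G} -> is_step F g -> is_step G h -> g <= h.
Proof.
move=> sFG Fg Gh; rewrite contmap_leE => x; apply: (Fg x).2 => u [U UF Ux].
by apply: (Gh x).1; exists U => //; exact: sFG.
Qed.

Definition steps := [set g | exists2 F, step_spec F & is_step F g].

Lemma steps_directed : directed steps.
Proof.
have [F FF] := step_spec_exists; have [g gF] := step_exists FF.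
split; first by exists g, F.
move=> {F FF g gF} g h [F FF gF] [G GG hG].
have FG := step_cat FF GG.1; have [k kFG] := step_exists FG.
exists k; first by exists (F ++ G).
by split; [apply: step_le gF kFG|apply: step_le hG kFG] => p pF;
  rewrite mem_cat pF ?orbT.
Qed.

(** Every u way below f x is a value at x of some step map: adjoin to a spec the
pair (V, u) with x in V and V way below the preimage of the points way above
u. *)
Lemma steps_lub : isLub steps f.
Proof.
split=> [g [F FF gF]|b ub]; rewrite contmap_leE => x.
  by apply: (gF x).2 => u; exact: step_vals_le.
apply: (L_cont.2 (f x)).2.2 => u ufx.
have [V Vu Vx] := @step_refine (above_pre u) x ufx.
have [F FF] := step_spec_exists.
have FG : step_spec (F ++ [:: (V, u)]).
  by apply: step_cat FF _ => p; rewrite inE => /eqP ->.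
have [g gF] := step_exists FG.
have /ub : steps g by exists (F ++ [:: (V, u)]).
rewrite contmap_leE => /(_ x); apply: le_trans.
by apply: (gF x).1; exists V => //; rewrite mem_cat inE eqxx orbT.
Qed.

(** If U is way below the preimage under h of the points way above u, then h is
above u on U; the set of these h is Isbell open since both way-below conditions
are Scott open by interpolation. *)
Lemma step_isbell_nbhs F g : step_spec F -> is_step F g ->
  exists N : set (contmap X L), [/\ @open (isbell X L) N, N f &
    forall h, N h -> g <= h].
Proof.
move=> FF gF.
suff [N [oN Nf NF]] : exists N : set (contmap X L), [/\ @open (isbell X L) N, N f &
    forall h, N h -> forall p, p \in F ->
      way_below p.1 (contmap_preimage h (above_opens L_cont p.2))].
  exists N; split=> // h /NF Nh; rewrite contmap_leE => x.
  apply: (gF x).2 => u [U /Nh /= /way_below_le + Ux].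
  by rewrite opens_leE => /(_ x Ux); exact: way_below_le.
have {FF gF} := FF.1; elim: F => [_|[U u] F IH FF].
  by exists setT; split=> //; exact: (@openT (isbell X L)).
have [p pF|N [oN Nf NF]] := IH; first by apply: FF; rewrite inE pF orbT.
pose N' := isbell_subbasic (L := L) [set V | way_below U V] (above_opens L_cont u).
exists (N `&` N'); split=> [||h [Nh N'h] p].
- apply: (@openI (isbell X L)) => //; apply: isbell_subbasic_open.
  exact: scott_open_way_above.
- by split=> //; apply: (FF (U, u)); rewrite inE eqxx.
- by rewrite inE => /predU1P[->//|]; exact: NF.
Qed.

End Approximation.

Lemma scott_open_isbell_open (X : topologicalType) d (L : porderType d)
    (W : set (contmap X L)) :
  cover_compact [set: X] -> core_compact X ->
  continuous_dcpo L -> conditionally_bounded_complete L ->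
  scott_open W -> @open (isbell X L) W.
Proof.
move=> X_compact X_cc L_cont L_cbc [upW inW].
rewrite openE => f Wf.
have [g [F FF gF] Wg] := inW _ _ (steps_directed X_compact X_cc L_cont L_cbc f)
  (steps_lub X_compact X_cc L_cont L_cbc f) Wf.
have [N [oN Nf Ng]] := step_isbell_nbhs X_cc FF gF.
rewrite /interior/=; rewrite nbhsE; exists N; first by split.
by move=> h /Ng; exact: upW.
Qed.

(** * A discrete space with two points at infinity *)

Section CompactOpens.
Context {X : topologicalType}.
Implicit Types (U V K : opens X).

(** In the lattice of open sets an element way below itself is a compact open
set; a space with a base of them is core compact because they are closed under
finite unions. *)
Lemma core_compact_basis :
  (forall U (x : X), (U : set X) x ->
    exists2 K : opens X, way_below K K & K <= U /\ (K : set X) x) ->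
  core_compact X.
Proof.
move=> basis; split=> [|U]; first exact: opens_dcpo.
pose KU := [set K : opens X | way_below K K /\ K <= U].
have dKU : directed KU.
  split.
    exists (open_set open0); split; last by rewrite opens_leE; exact: sub0set.
    by move=> D s [[V DV] _] _ _; exists V => //; rewrite opens_leE; exact: sub0set.
  move=> K1 K2 [cK1 K1U] [cK2 K2U].
  pose K := open_set (openU (opens_open K1) (opens_open K2)).
  have K_le (V : opens X) : K1 <= V -> K2 <= V -> K <= V.
    by rewrite !opens_leE subUset.
  have K1K : K1 <= K by rewrite opens_leE; exact: subsetUl.
  have K2K : K2 <= K by rewrite opens_leE; exact: subsetUr.
  exists K => //; split; last exact: K_le.
  move=> D s dD Ds Ks.
  have [V1 DV1 KV1] := cK1 _ _ dD Ds (le_trans K1K Ks).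
  have [V2 DV2 KV2] := cK2 _ _ dD Ds (le_trans K2K Ks).
  have [V DV [V1V V2V]] := dD.2 _ _ DV1 DV2.
  by exists V => //; apply: K_le; [exact: le_trans V1V|exact: le_trans V2V].
have lKU : isLub KU U.
  split=> [K []//|b ub]; rewrite opens_leE => x /basis[K cK [KU' Kx]].
  by have := ub K (conj cK KU'); rewrite opens_leE; exact.
split.
  have KU_wb K : KU K -> way_below K U.
    by move=> [cK KleU]; exact: way_below_trans (lexx _) cK KleU.
  split; first by have [K /KU_wb] := dKU.1; exists K.
  move=> V1 V2 /(_ _ _ dKU lKU (lexx U))[K1 KK1 V1K1].
  move=> /(_ _ _ dKU lKU (lexx U))[K2 KK2 V2K2].
  have [K KK [K1K K2K]] := dKU.2 _ _ KK1 KK2.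
  exists K; first exact: KU_wb.
  by split; [exact: le_trans K1K|exact: le_trans K2K].
split=> [V /way_below_le//|b ub]; apply: lKU.2 => K [cK KleU].
by apply: ub; exact: way_below_trans (lexx _) cK KleU.
Qed.

(** An open set is compact as soon as it has a point all of whose neighbourhoods
omit finitely many points of it: one member of a directed cover contains the
point, and the finitely many points left are absorbed by directedness. *)
Lemma focal_compact K (x : X) :
  (K : set X) x ->
  (forall V, (V : set X) x -> finite_set ((K : set X) `\` V)) ->
  way_below K K.
Proof.
move=> Kx K_fin D s dD Ds; rewrite opens_leE (isLub_opens Ds) => Ks.
have [V DV Vx] := Ks _ Kx.
have /finite_seqP[l lE] := K_fin V Vx.
suff [W DW [VW lW]] : exists2 W : opens X, D W &
    V <= W /\ forall y, y \in l -> (W : set X) y.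
  exists W => //; rewrite opens_leE => y Ky.
  have [Vy|nVy] := pselect ((V : set X) y).
    by move: VW; rewrite opens_leE; exact.
  by apply: lW; have : [set` l] y by rewrite -lE.
have : forall y, y \in l -> (K : set X) y.
  by move=> y yl; have : [set` l] y by []; rewrite -lE => -[].
elim: l {lE} => [_|y l IH lK]; first by exists V.
have [z zl|W DW [VW lW]] := IH; first by apply: lK; rewrite inE zl orbT.
have [W' DW' W'y] := Ks y (lK y (mem_head _ _)).
have [W2 DW2 [WW2 W'W2]] := dD.2 _ _ DW DW'.
move: (WW2) (W'W2); rewrite !opens_leE => sW sW'.
exists W2 => //; split; first exact: le_trans WW2.
by move=> z; rewrite inE => /predU1P[->|/lW]; [exact: sW'|exact: sW].
Qed.

End CompactOpens.

Definition two_ended (I : Type) : Type := (I + bool)%type.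

Section TwoEnded.
Variable I : Type.

HB.instance Definition _ := gen_eqMixin (two_ended I).
HB.instance Definition _ := gen_choiceMixin (two_ended I).

Definition two_ended_open (U : set (two_ended I)) :=
  forall s : bool, U (inr s) -> finite_set (~` U).

Let two_ended_openT : two_ended_open [set: two_ended I].
Proof. by move=> s _; rewrite setCT; exact: finite_set0. Qed.

Let two_ended_openI (U V : set (two_ended I)) :
  two_ended_open U -> two_ended_open V -> two_ended_open (U `&` V).
Proof.
by move=> oU oV s [/oU finU /oV finV]; rewrite setCI finite_setU.
Qed.

Let two_ended_open_bigU (J : Type) (f : J -> set (two_ended I)) :
  (forall j, two_ended_open (f j)) -> two_ended_open (\bigcup_j f j).
Proof.
move=> fo s [j _ fjs]; apply: sub_finite_set (fo j s fjs).
by apply: subsetC; exact: bigcup_sup.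
Qed.

HB.instance Definition _ := isOpenTopological.Build (two_ended I)
  two_ended_openT two_ended_openI two_ended_open_bigU.

Lemma cofinite_open (U : set (two_ended I)) :
  (forall s, U (inr s) -> finite_set (~` U)) -> open U.
Proof. by []. Qed.

Lemma end_cofinite (U : set (two_ended I)) s :
  open U -> U (inr s) -> finite_set (~` U).
Proof. by move=> /(_ s). Qed.

Lemma two_ended_compact : cover_compact [set: two_ended I].
Proof.
move=> J D f f_open f_cover.
have pick x : exists2 j, D j & f j x by have [j] := f_cover x Logic.I; exists j.
have [j0 Dj0 fj0] := pick (inr true).
have /finite_seqP[l lE] := end_cofinite (f_open _ Dj0) fj0.
have [j jP] := choice (fun x => let: ex_intro2 j a b := pick x in
  ex_intro (fun j => D j /\ f j x) j (conj a b)).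
exists [fset k in j0 :: map j l]%fset.
  move=> k; rewrite !inE /= => /predU1P[->|/mapP[x _ ->]]; apply: mem_set => //.
  exact: (jP x).1.
move=> x _; have [fx|nfx] := pselect (f j0 x).
  by exists j0 => //=; rewrite !inE eqxx.
exists (j x); last exact: (jP x).2.
rewrite /= !inE /=; apply/orP; right; apply: map_f.
by have : [set` l] x by rewrite -lE.
Qed.

Definition end_nbhd (s : bool) : set (two_ended I) := ~` [set inr (~~ s)].

Lemma end_nbhd_open s : open (end_nbhd s).
Proof. by move=> t _; rewrite /end_nbhd setCK; exact: finite_set1. Qed.

Lemma isolated_open (A : set I) : open (inl @` A : set (two_ended I)).
Proof. by move=> s [i]. Qed.

Lemma end_compact (U : opens (two_ended I)) s :
  (U : set _) (inr s) ->
  let K := open_set (openI (opens_open U) (@end_nbhd_open s)) in way_below K K.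
Proof.
move=> Us K; apply: (@focal_compact _ _ (inr s : two_ended I)) => [|V Vs].
  by split=> //; case: s {Us K}.
by apply: sub_finite_set (end_cofinite (opens_open V) Vs) => x [].
Qed.

Lemma two_ended_core_compact : core_compact (two_ended I).
Proof.
apply: core_compact_basis => U [i|s] Ux.
  exists (open_set (@isolated_open [set i])).
    apply: (@focal_compact _ _ (inl i : two_ended I)) => [|V Vi]; first by exists i.
    suff -> : (inl @` [set i] : set (two_ended I)) `\` V = set0.
      exact: finite_set0.
    by apply/seteqP; split=> // _ [[_ -> <-]].
  by split; [rewrite opens_leE => _ [_ -> <-]|exists i].
exists (open_set (openI (opens_open U) (@end_nbhd_open s))).
  exact: end_compact.
split; first by rewrite opens_leE; exact: subIsetl.
by split=> //; case: s {Ux}.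
Qed.

End TwoEnded.

Arguments end_nbhd_open : clear implicits.
Arguments isolated_open {I} A.

(** * Scott open sets on the two-ended space *)

Section Separation.
Context {d : Order.disp_t} {L : porderType d}.
Hypothesis L_cont : continuous_dcpo L.
Implicit Types E : bool -> L.

(** A pair of elements of L is a function on [bool], so that the two points at
infinity [inr s] and the two elements of a pair share their index; [ub2 E] is
the set of common upper bounds of the pair E. *)
Definition ub2 E : set L := [set y | forall s, E s <= y].

Definition wb2 E' E := forall s, way_below (E' s) (E s).

(** A Scott open set containing E s contains all values of q, so its preimage is
cofinite whenever it contains a point at infinity. *)
Lemma two_ended_map (I : Type) E (q : I -> L) : (forall i, ub2 E (q i)) ->
  exists g : contmap (two_ended I) L,
    (forall i, g (inl i) = q i) /\ (forall s, g (inr s) = E s).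
Proof.
move=> qE; pose t (x : two_ended I) := match x with inl i => q i | inr s => E s end.
have [V [upV _]|g gt] := @contmap_of (two_ended I) _ L t.
  apply: cofinite_open => s /= VEs.
  apply: sub_finite_set (finite_set1 (inr (~~ s))) => -[i|s'] /=.
    by case; apply: upV VEs _; exact: qE.
  by case: s s' VEs => -[].
by exists g; rewrite gt.
Qed.

Variables (I : Type) (E' E : bool -> L) (c : L) (C : set (I -> L)).
Hypotheses (E'E : wb2 E' E) (c_ub : ub2 E c).
Hypothesis C_lower : forall g h : I -> L, (forall i, g i <= h i) -> C h -> C g.
Hypothesis C_sup : forall (G : set (I -> L)) (t : I -> L),
  G !=set0 ->
  (forall g h, G g -> G h ->
    exists2 k, G k & forall i, g i <= k i /\ h i <= k i) ->
  (forall g, G g -> C g /\ forall i, ub2 E' (g i)) ->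
  (forall i, isLub [set g i | g in G] (t i)) -> C t.
Hypothesis C_dense : forall F : set I, finite_set F ->
  exists q, [/\ C q, (forall i, ub2 E (q i)) & forall i, F i -> q i = c].

(** The maps whose values on the compact open set [end_nbhd s] are way above
E' s, for both s.  This set is Scott open, and its members take common upper
bounds of E' as values on I. *)
Let ends_ok : set (contmap (two_ended I) L) :=
  [set g | forall s, way_below (open_set (end_nbhd_open I s))
    (contmap_preimage g (above_opens L_cont (E' s)))].

Let endK s : let K := open_set (end_nbhd_open I s) in way_below K K.
Proof.
have := @end_compact I (open_set openT) s Logic.I.
suff -> : open_set (openI (opens_open (open_set openT)) (end_nbhd_open I s)) =
  open_set (end_nbhd_open I s) by [].
by apply: opens_inj; rewrite /= setTI.
Qed.

Let ends_okP g : ends_ok g <->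
  forall s x, end_nbhd s x -> way_below (E' s) (g x).
Proof.
split=> [gE s x sx|gE s].
  by have /way_below_le := gE s; rewrite opens_leE; exact.
apply: way_below_trans (lexx _) (@endK s) _; rewrite opens_leE.
exact: gE.
Qed.

Let ends_ok_ub g : ends_ok g -> forall i, ub2 E' (g (inl i)).
Proof. by move=> /ends_okP gE i s; apply/way_below_le/gE; case: s. Qed.

Let ends_ok_open : scott_open ends_ok.
Proof.
pose B s := isbell_subbasic (L := L)
  [set V | way_below (open_set (end_nbhd_open I s)) V] (above_opens L_cont (E' s)).
have oB s : scott_open (B s).
  apply: isbell_subbasic_scott_open; first exact: L_cont.1.
  exact: scott_open_way_above (@two_ended_core_compact I) _.
have -> : ends_ok = B true `&` B false.
  by apply/seteqP; split=> [g gE|g [gt gf] [|]//]; split; exact: gE.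
exact: (@openI (scott (contmap (two_ended I) L)) _ _ (oB true) (oB false)).
Qed.

Let sep : set (contmap (two_ended I) L) :=
  [set g | ends_ok g /\ ~ C (fun i => g (inl i))].

Let sep_open : scott_open sep.
Proof.
split=> [g h [gE gC] gh|D s dD Ds [sE sC]].
  split; first exact: ends_ok_open.1 gE gh.
  apply: contra_not gC; apply: C_lower => i.
  by move: gh; rewrite contmap_leE.
have [g0 Dg0 g0E] := ends_ok_open.2 _ _ dD Ds sE.
apply: contrapT => noD; apply: sC.
pose D' := [set g | D g /\ g0 <= g].
pose r (g : contmap (two_ended I) L) i : L := g (inl i).
apply: (C_sup (G := r @` D')).
- by exists (r g0), g0.
- move=> _ _ [g [Dg g0g] <-] [h [Dh _] <-].
  have [k Dk [gk hk]] := dD.2 _ _ Dg Dh.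
  exists (r k); first by exists k => //; split=> //; exact: le_trans gk.
  by move: gk hk; rewrite !contmap_leE => gk hk i; split; [exact: gk|exact: hk].
- move=> _ [g [Dg g0g] <-]; have gE := ends_ok_open.1 _ _ g0E g0g.
  split; last exact: ends_ok_ub.
  by apply: contrapT => gC; apply: noD; exists g.
- move=> i; have [ub lb] := contmap_lub L_cont.1 dD Ds (inl i).
  split=> [_ [_ [g [Dg _] <-] <-]|b bub]; first by apply: ub; exists g.
  apply: lb => _ [g Dg <-]; have [k Dk [gk g0k]] := dD.2 _ _ Dg Dg0.
  apply: (@le_trans _ _ (k (inl i))); first by move: gk; rewrite contmap_leE.
  by apply: bub; exists (r k) => //; exists k.
Qed.

(** A subbasic set [H, V] either contains a value of f at infinity in V, and then
V contains all common upper bounds of E; or the preimage of V under f lies in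
the discrete part, where it is the directed union of its finite subsets, one of
which is in H. *)
Let isbell_finite (f : contmap (two_ended I) L) (W : set (contmap (two_ended I) L)) :
  (forall i, f (inl i) = c) -> (forall s, f (inr s) = E s) ->
  @open (isbell (two_ended I) L) W -> W f ->
  exists2 F : set I, finite_set F & forall g : contmap (two_ended I) L,
    (forall s, g (inr s) = E s) -> (forall i, ub2 E (g (inl i))) ->
    (forall i, F i -> g (inl i) = c) -> W g.
Proof.
move=> fc fE; move: W; apply: isbell_ind => [_|U V IU IV|F IF|H V [upH inH] HV].
- by exists set0.
- move=> [/IU[FU finFU FUP] /IV[FV finFV FVP]].
  exists (FU `|` FV); first by rewrite finite_setU.
  by move=> g gE gub gc; split; [apply: FUP|apply: FVP] => // i Fi; apply: gc;
    [left|right].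
- move=> [W FW /(IF _ FW)[F' finF' F'P]]; exists F' => // g gE gub gc.
  by exists W => //; exact: F'P.
have oV : scott_open (V : set L) := opens_open V.
have [[s Vs]|nV] := pselect (exists s, (V : set L) (E s)).
  exists set0 => // g gE gub _; apply: upH HV _; rewrite opens_leE => -[i _|t] /=.
    by apply: oV.1 Vs _; exact: gub.
  by rewrite fE gE.
pose fin (A : set I) := open_set (isolated_open A).
pose Vc := [set i : I | (V : set L) c].
pose D := [set fin (A `&` Vc) | A in finite_set].
have dD : directed D.
  split; first by exists (fin (set0 `&` Vc)), set0.
  move=> _ _ [A finA <-] [B finB <-]; exists (fin ((A `|` B) `&` Vc)).
    by exists (A `|` B) => //; rewrite /= finite_setU.
  by split; rewrite opens_leE; apply: image_subset; apply: setSI;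
    [exact: subsetUl|exact: subsetUr].
have lD : isLub D (contmap_preimage f V).
  suff -> : contmap_preimage f V = opens_cup D by exact: isLub_opens_cup.
  apply: opens_inj; apply/seteqP; split=> [[i|s] /=|_ [_ [A finA <-] [i [Ai Vci] <-]]].
  - rewrite fc => Vci; exists (fin ([set i] `&` Vc)); last by exists i.
    by exists [set i].
  - by rewrite fE => VE; case: nV; exists s.
  - by rewrite /= fc.
have [_ [A finA <-] HA] := inH _ _ dD lD HV.
exists A => // g gE gub gc; apply: upH HA _.
by rewrite opens_leE => _ [i [Ai Vci] <-] /=; rewrite gc.
Qed.

(** If C did not contain the constant function c, the maps of [ends_ok] whose
restriction to I is not in C would form a Scott open neighbourhood of the map
with value c on I and values E at infinity.  As it is Isbell open, it contains
every map with the same values at infinity whose values on I are common upper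
bounds of E, equal to c on some finite set; the density of C provides one that
is in C. *)
Lemma separation :
  @open (isbell (two_ended I) L) = @open (scott (contmap (two_ended I) L))
    :> set (set (contmap (two_ended I) L)) ->
  C (fun=> c).
Proof.
move=> coincide; apply: contrapT => nC.
have [f [fc fE]] := @two_ended_map I E (fun=> c) (fun=> c_ub).
have sep_f : sep f.
  split; last by apply: contra_not nC; apply: C_lower => i; rewrite fc.
  apply/ends_okP => s [i|t] sx.
    by rewrite fc; exact: way_below_trans (lexx _) (@E'E s) (c_ub s).
  rewrite fE; suff -> : t = s by exact: E'E.
  by move: sx; case: s t => -[] // /(_ erefl).
have : @open (isbell (two_ended I) L) sep by rewrite coincide; exact: sep_open.
move=> /(isbell_finite fc fE)/(_ sep_f)[F finF FP].
have [q [qC qub qc]] := C_dense finF.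
have [g [gq gE]] := two_ended_map qub.
have [|i|i Fi|_] := FP g => //; rewrite ?gq//; first exact: qc.
by apply; apply: C_lower qC => i; rewrite gq.
Qed.

End Separation.

(** * Well-founded recursion *)

Definition strict_wo (T : Type) (lt : T -> T -> Prop) :=
  [/\ well_founded lt, (forall x y z, lt x y -> lt y z -> lt x z) &
      forall x y, [\/ lt x y, x = y | lt y x]].

Lemma wf_irreflexive (T : Type) (lt : T -> T -> Prop) x :
  well_founded lt -> ~ lt x x.
Proof. by move=> wf; elim/(well_founded_ind wf): x => x IH /[dup]; exact: IH. Qed.

Lemma wf_least (T : Type) (lt : T -> T -> Prop) (Q : T -> Prop) x :
  well_founded lt -> Q x -> exists2 y, Q y & forall z, lt z y -> ~ Q z.
Proof.
move=> wf; elim/(well_founded_ind wf): x => x IH Qx.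
have [[y yx Qy]|noy] := pselect (exists2 y, lt y x & Q y); first exact: IH yx Qy.
by exists x => // z zx Qz; apply: noy; exists z.
Qed.

Lemma strict_wo_exists (T : eqType) : exists lt : T -> T -> Prop, strict_wo lt.
Proof.
have [R woR] := well_ordering_principle T.
have wo : wo_chain R predT by move=> A _; exact: woR.
have refl x : R x x by apply: (wo_chain_reflexive wo).
have anti x y : R x y -> R y x -> x = y.
  by move=> xy yx; apply: (wo_chain_antisymmetric wo) => //; rewrite xy yx.
pose lt x y := R x y /\ x <> y.
exists lt; split=> [x|x y z [xy nxy] [yz nyz]|x y].
- apply: contrapT => nAccx.
  have [|z [[]]] := woR (fun z => `[< ~ Acc lt z >]); first by exists x; apply/asboolP.
  move=> /asboolP nAccz zmin _; apply: nAccz; constructor => y [yz nyz].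
  apply: contrapT => nAccy; apply: nyz; apply: anti yz _.
  by apply: zmin; apply/asboolP.
- have [|m [[+ mmin] _]] := woR [in [:: x; y; z]].
    by exists x; rewrite !inE eqxx.
  have mx : R m x by apply: mmin; rewrite !inE eqxx.
  have my : R m y by apply: mmin; rewrite !inE eqxx orbT.
  have mz : R m z by apply: mmin; rewrite !inE eqxx !orbT.
  rewrite !inE => /or3P[]/eqP mE; subst m.
  + by split=> // xz; apply: nxy; apply: anti => //; rewrite xz.
  + by case: nxy; exact: anti.
  + by case: nyz; exact: anti.
- have [->|/eqP xy] := eqVneq x y; first by constructor 2.
  have /orP[Rxy|Ryx] : R x y || R y x by apply: (wo_chainW wo).
    by constructor 1.
  by constructor 3; split=> // /esym.
Qed.

(** Call S a thin at a when two members of S a that agree below a are equal.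
Then phi is built by recursion so as to avoid all thin S a: at most one member
psi of S a extends the restriction of phi below a, and phi a is chosen different
from psi a. *)
Lemma diagonal (T : Type) (lt : T -> T -> Prop) (S : T -> set (T -> bool)) :
  well_founded lt ->
  exists phi, forall a,
    (forall psi1 psi2, S a psi1 -> S a psi2 ->
      (forall b, lt b a -> psi1 b = psi2 b) -> psi1 = psi2) -> ~ S a phi.
Proof.
move=> wf.
pose step a (rec : forall b, lt b a -> bool) := `[< ~ exists psi : T -> bool,
  [/\ S a psi, forall b (ba : lt b a), psi b = rec b ba & psi a] >].
pose phi := Fix wf (fun=> bool) step.
have phiE a : phi a = `[< ~ exists psi : T -> bool,
    [/\ S a psi, forall b, lt b a -> psi b = phi b & psi a] >].
  rewrite /phi Fix_eq// => x f g fg; congr step.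
  by apply: functional_extensionality_dep => b; apply: functional_extensionality_dep.
exists phi => a Sa Saphi; have := phiE a; case phia : (phi a) => /esym.
  by move=> /asboolP; apply; exists phi.
move=> /asboolPn /contrapT [psi [Spsi agree psia]].
by move: phia; rewrite -(Sa _ _ Spsi Saphi agree) psia.
Qed.

(** * Lower bounds of sets of common upper bounds *)

Section Order.
Context {d : Order.disp_t} {L : porderType d}.
Hypothesis L_cont : continuous_dcpo L.
Hypothesis coincide : forall I : Type,
  @open (isbell (two_ended I) L) = @open (scott (contmap (two_ended I) L))
    :> set (set (contmap (two_ended I) L)).
Implicit Types E : bool -> L.

Lemma wb2_le E' E s : wb2 E' E -> E' s <= E s.
Proof. by move=> /(_ s); exact: way_below_le. Qed.

Lemma ub2_wb E' E y : wb2 E' E -> ub2 E y -> ub2 E' y.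
Proof. by move=> E'E Ey s; apply: le_trans (wb2_le s E'E) _. Qed.

Lemma wb2_interpolate E' E : wb2 E' E -> exists2 r, wb2 E' r & wb2 r E.
Proof.
move=> E'E; have ex s : exists y, way_below (E' s) y /\ way_below y (E s).
  by have [y] := way_below_interpolate L_cont (@E'E s); exists y.
by have [r rP] := choice ex; exists r => s; have [] := rP s.
Qed.

(** The box of points with both coordinates below k gives the value c on any
prescribed finite set; the column p.1 == k makes distinct patterns incompatible:
for k < k', the patterns of index k and k' are c and e at the point (k, k'). *)
Definition box_pattern (c e : L) (k : nat) (p : nat * nat) : L :=
  if [|| (p.1 < k)%N && (p.2 < k)%N | p.1 == k] then c else e.

Lemma box_bound (l : seq (nat * nat)) :
  exists k, forall p, p \in l -> (p.1 < k)%N && (p.2 < k)%N.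
Proof.
elim: l => [|[i j] l [k kP]]; first by exists 0.
exists (maxn k (maxn i j).+1) => p; rewrite inE => /predU1P[->|/kP/andP[p1 p2]] /=.
  by rewrite !leq_max !ltnS !leq_max !leqnn !orbT.
by rewrite !leq_max p1 p2.
Qed.

(** Let C consist of the functions below some pattern [box_pattern c e k].  If c
and e had no lower bound in [ub2 E'], a function with values in [ub2 E'] would be
below at most one pattern, so a directed family in C would stay below a single
one, and C would satisfy the hypotheses of [separation].  But the constant c is
below a pattern only if c <= e, and then c itself is the lower bound sought. *)
Lemma pair_lower_bound E' E c e : wb2 E' E -> ub2 E c -> ub2 E e ->
  exists x, [/\ ub2 E' x, x <= c & x <= e].
Proof.
move=> E'E Ec Ee; apply: contrapT => nolb.
pose q := box_pattern c e.
have q_ub k p : ub2 E (q k p) by rewrite /q /box_pattern; case: ifP.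
have q_disj k k' (g : nat * nat -> L) : (forall p, ub2 E' (g p)) -> (k < k')%N ->
    (forall p, g p <= q k p) -> ~ (forall p, g p <= q k' p).
  move=> gE' kk' gk gk'; apply: nolb; exists (g (k, k')).
  have := gk (k, k'); have := gk' (k, k').
  by rewrite /q /box_pattern /= eqxx orbT kk' ltnn (ltn_eqF kk').
have [g h gh [k hk]|G t G0 dG GC tG|F /finite_seqP[l ->]|k ck] :=
    separation L_cont (C := [set g | exists k, forall p, g p <= q k p]) E'E Ec _ _ _
      (@coincide _).
- by exists k => p; exact: le_trans (hk p).
- have [g0 Gg0] := G0; have [[k g0k] g0E'] := GC _ Gg0.
  exists k => p; apply: (tG p).2 => _ [g Gg <-].
  have [h Gh gh] := dG _ _ Gg Gg0; have [[k' hk'] _] := GC _ Gh.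
  apply: le_trans (gh p).1 _.
  have g0k' p' : g0 p' <= q k' p' by apply: le_trans (gh p').2 _.
  by case: (ltngtP k k') => [kk'|kk'|->//]; case: (q_disj _ _ g0 g0E' kk').
- have [k kP] := box_bound l; exists (q k); split=> // [|p /kP].
    by exists k.
  by rewrite /q /box_pattern => ->.
have := ck (k.+1, k.+1); rewrite /q /box_pattern /= ltnNge leqnSn /= (gtn_eqF (ltnSn k)).
by move=> ce; apply: nolb; exists c; split=> //; exact: ub2_wb Ec.
Qed.

(** Setting for the contradiction below.  The elements [low a] have no lower
bound in [ub2 E'], while the elements [low b] with b before a have the lower
bound [mid a] in the smaller set [ub2 E]. *)
Section Staircase.
Variables (T : Type) (lt : T -> T -> Prop) (low : T -> L) (mid : T -> L).
Variables (E' E : bool -> L) (c : L).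
Hypotheses (lt_wo : strict_wo lt) (lt_nolast : forall a, exists b, lt a b).
Hypotheses (E'E : wb2 E' E) (c_ub : ub2 E c).
Hypothesis low_nolb : forall y, ub2 E' y -> exists a, ~ y <= low a.
Hypothesis mid_ub : forall a, ub2 E (mid a).
Hypothesis mid_low : forall a b, lt b a -> mid a <= low b.

(** The classical alias provides decidable equality on maps, used to list finite
sets of them. *)
Let I := {classic (T -> bool)}.

Let agree (a : T) (phi psi : I) := forall b, lt b a -> phi b = psi b.

Let thin (a : T) (S : set I) :=
  forall phi psi, S phi -> S psi -> agree a phi psi -> phi = psi.

Let tall (a : T) (g : I -> L) : set I :=
  [set phi | exists2 b, lt b a & ~ g phi <= low b].

Let lt_wf : well_founded lt. Proof. by case: lt_wo. Qed.

Let lt_trans a b e : lt a b -> lt b e -> lt a e.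
Proof. by case: lt_wo => _ + _; apply. Qed.

Let lt_le_trans a b e : lt a b -> ~ lt e b -> lt a e.
Proof.
case: lt_wo => _ _ /(_ b e) tot ab neb.
by case: tot => [be|<-//|//]; exact: lt_trans ab be.
Qed.

(** Finitely many distinct maps are separated by finitely many points of T, and T
has no last element, so they are separated below some a. *)
Let thin_finite (a0 : T) (F : set I) : finite_set F -> exists2 a, lt a0 a & thin a F.
Proof.
move=> /finite_seqP[l lF].
suff [a a0a aP] : exists2 a, lt a0 a & forall p : I * I,
    p \in [seq (phi, psi) | phi <- l, psi <- l] -> agree a p.1 p.2 -> p.1 = p.2.
  exists a => // phi psi; rewrite lF /= => phil psil; apply: (aP (phi, psi)).
  by apply/allpairsP; exists (phi, psi).
elim: [seq _ | _ <- _, _ <- _] => [|[phi psi] s [a a0a aP]].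
  by have [a a0a] := lt_nolast a0; exists a.
have [<-|/eqP nE] := eqVneq phi psi.
  by exists a => // p; rewrite inE => /predU1P[->//|]; exact: aP.
have [b nb] : exists b, phi b <> psi b.
  by apply/existsNP; apply: contra_not nE => /funext.
have [b' [bb' nb'a]] : exists b', lt b b' /\ ~ lt b' a.
  have [b' bb'] := lt_nolast b.
  have [b'a|] := pselect (lt b' a); last by exists b'.
  by exists a; split; [exact: lt_trans b'a|exact: wf_irreflexive lt_wf].
exists b'; first exact: lt_le_trans a0a _.
move=> p; rewrite inE => /predU1P[->/(_ b bb')//|ps] ag; apply: aP ps _ => e ea.
by apply: ag; exact: lt_le_trans ea _.
Qed.

(** Let C consist of the functions g for which [tall a g] is thin at a, for some
a after b0.  The function with value c on a finite set and value [mid a] elsewhere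
is in C, as its tall part is finite.  The constant c is not: it is tall
everywhere, and the set of all maps is not thin at any a.  The contradiction with
[separation] is that C is closed under the directed suprema considered there.
For g with values in [ub2 E'], the set of the good indices a is bounded: if it
were cofinal, the diagonal map phi would be in no [tall a g], that is, g phi
would be a lower bound of all [low b].  Along a directed family the sets of good
indices decrease; being nonempty and bounded they have a limit l, and l is a good
index of the supremum, since two points that are tall for it before l are already
tall for some member of the family at one of its good indices near l. *)
Lemma staircase_contradiction : False.
Proof.
have [b0 cb0] := low_nolb (ub2_wb E'E c_ub).
pose A (g : I -> L) : set T := [set a | lt b0 a /\ thin a (tall a g)].
have A_anti g h : (forall phi, g phi <= h phi) -> A h `<=` A g.
  move=> gh a [b0a hthin]; split=> // phi psi [b ba nb] [b' b'a nb'].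
  apply: hthin; first by exists b => //; apply: contra_not nb; exact: le_trans.
  by exists b' => //; apply: contra_not nb'; exact: le_trans.
have [g h gh [a ha]|G t G0 dG GC tG|F finF|a [b0a a_thin]] :=
    separation L_cont (C := [set g | A g !=set0]) E'E c_ub _ _ _ (@coincide I).
- by exists a; exact: A_anti ha.
- have [g0 Gg0] := G0; have [_ g0E'] := GC _ Gg0.
  have [m mP] : exists m, forall a, A g0 a -> ~ lt m a.
    apply: contrapT => unb.
    have {}unb b : exists2 a, A g0 a & lt b a.
      apply: contrapT => nb; apply: unb; exists b => a ga ba.
      by apply: nb; exists a.
    have [phi phiP] := diagonal (fun a => tall a g0) lt_wf.
    have [b] := low_nolb (g0E' phi); apply.
    have [a [b0a athin] ba] := unb b; apply: contrapT => nb.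
    by apply: (phiP a athin); exists b.
  (* the least l with Q is the limit of the least good indices of the family *)
  pose Q l := forall g, G g -> exists2 a, A g a & ~ lt l a.
  have Qm : Q m.
    move=> g Gg; have [h Gh gh] := dG _ _ Gg Gg0; have [[a ha] _] := GC _ Gh.
    exists a; first by apply: A_anti ha => phi; exact: (gh phi).1.
    by apply: mP; apply: A_anti ha => phi; exact: (gh phi).2.
  have [l Ql lmin] := wf_least lt_wf Qm.
  have beyond b : lt b l -> exists2 g, G g & forall a, A g a -> lt b a.
    move=> /lmin /existsNP[g /not_implyP[Gg nA]]; exists g => // a ga.
    by apply: contrapT => nba; apply: nA; exists a.
  have G_above phi : tall l t phi -> exists2 g, G g &
      forall h, G h -> (forall psi, g psi <= h psi) -> forall a, A h a -> tall a h phi.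
    move=> [b' b'l tb'].
    have [g1 Gg1 g1P] := beyond _ b'l.
    have [g2 Gg2 g2b'] : exists2 g, G g & ~ g phi <= low b'.
      apply: contrapT => nG; apply: tb'; apply: (tG phi).2 => _ [g Gg <-].
      by apply: contrapT => ng; apply: nG; exists g.
    have [g Gg gP] := dG _ _ Gg1 Gg2; exists g => // h Gh gh a ha.
    exists b'; first by apply: g1P; apply: A_anti ha => psi; exact: le_trans (gP psi).1 _.
    by apply: contra_not g2b'; apply: le_trans; exact: le_trans (gP phi).2 _.
  exists l; split.
    have [a [b0a _] nla] := Ql g0 Gg0.
    by apply: lt_le_trans b0a _.
  move=> phi psi /G_above[g Gg gP] /G_above[h Gh hP] ag.
  have [k Gk kP] := dG _ _ Gg Gh; have [a ka nla] := Ql k Gk.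
  apply: ka.2 => [||b ba].
  + by apply: gP => // x; exact: (kP x).1.
  + by apply: hP => // x; exact: (kP x).2.
  + by apply: ag; exact: lt_le_trans ba _.
- have [a b0a aF] := thin_finite b0 finF.
  exists (fun phi => if `[< F phi >] then c else mid a); split=> [|phi|phi Fphi].
  + exists a; split=> // phi psi; rewrite /tall /=.
    case: asboolP => [Fphi _|_ [b ba]]; last by case; exact: mid_low.
    case: asboolP => [Fpsi _|_ [b ba]]; last by case; exact: mid_low.
    exact: aF.
  + by case: ifP.
  + by rewrite asboolT.
have tall_c phi : tall a (fun=> c) phi by exists b0.
have ag : agree a (fun=> false) (fun b => `[< b = a >]).
  move=> b ba; apply/esym/asboolF => ba'; move: ba; rewrite ba'.
  exact: wf_irreflexive.
have := congr1 (fun phi : T -> bool => phi a) (a_thin _ _ (tall_c _) (tall_c _) ag).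
by rewrite /= asboolT.
Qed.

End Staircase.

(** Well-order L, and take an initial segment K of least length such that, for some
pair F' way below a pair F, the common upper bounds of F in K have no lower bound
in [ub2 F'].  Let r be a pair between F' and F.  By minimality the common upper
bounds of F before any element of K do have a lower bound, in [ub2 r].  Minimality
has to range over all pairs for this, since it is applied to the pairs r and F
instead of F' and F.  These are the data of [staircase_contradiction] for the
pairs F' and r.  There is no last element a, because [pair_lower_bound] would
combine a with the lower bound of its predecessors. *)
Lemma ub2_lower_bound E' E c : wb2 E' E -> ub2 E c ->
  exists2 x, ub2 E' x & forall y, ub2 E y -> x <= y.
Proof.
have [lt lt_wo] := strict_wo_exists L; have [lt_wf _ lt_tot] := lt_wo.
pose no_bound E' E (K : set L) := [/\ wb2 E' E, ub2 E !=set0 &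
  ~ exists2 x, ub2 E' x & forall y, ub2 E y -> K y -> x <= y].
pose bad a := exists E' E, no_bound E' E (lt^~ a).
move=> E'E Ec; apply: contrapT => nolb.
pose K := [set y | forall a, bad a -> lt y a].
have K_good a : K a -> ~ bad a.
  by move=> Ka /Ka; exact: wf_irreflexive.
have [F' [F [F'F [e Fe] Knolb]]] : exists F' F, no_bound F' F K.
  have [[a bad_a]|nobad] := pselect (exists a, bad a).
    have [{bad_a}a bad_a amin] := wf_least lt_wf bad_a.
    move: (bad_a) => [F' [F [F'F F0 alb]]]; exists F', F; split=> //.
    apply: contra_not alb => -[x F'x xK]; exists x => // y Fy ya; apply: xK => //.
    move=> a' bad_a'; have [aa'|<-//|a'a] := lt_tot a a'; last by case: (amin _ a'a).
    by have [_ tr _] := lt_wo; exact: tr aa'.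
  exists E', E; split=> //; first by exists c.
  apply: contra_not nolb => -[x E'x xK]; exists x => // y Ey; apply: xK => // a.
  by move=> bad_a; case: nobad; exists a.
have [r F'r rF] := wb2_interpolate F'F.
pose T := {y : L | ub2 F y /\ K y}.
pose ltT (x y : T) := lt (sval x) (sval y).
have segment (a : T) : exists x, ub2 r x /\
    forall b : T, ltT b a -> x <= sval b.
  apply: contrapT => nox; have [_ Ka] := svalP a.
  apply: (K_good _ Ka); exists r, F; split=> //; first by exists e.
  move=> [x rx xa]; apply: nox; exists x; split=> // b ba.
  by apply: xa => //; case: (svalP b).
have [mid midP] := choice segment.
apply: (@staircase_contradiction T ltT (fun a => sval a) mid F' r e).
- split=> [|x y z|x y].
  + suff acc z : forall w : T, sval w = z -> Acc ltT w by move=> w; exact: (acc (sval w)).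
    elim/(well_founded_ind lt_wf): z => z IH w wz; constructor => v vw.
    by apply: (IH (sval v)) => //; rewrite -wz.
  + by have [_ tr _] := lt_wo; exact: tr.
  + have [xy|xy|xy] := lt_tot (sval x) (sval y); first by constructor 1.
      by constructor 2; case: x y xy => x Kx [y Ky] /= xy; exact: eq_exist.
    by constructor 3.
- move=> a; apply: contrapT => alast.
  have [x [F'x xmid xa]] := pair_lower_bound F'r (midP a).1 (ub2_wb rF (svalP a).1).
  apply: Knolb; exists x => // y Fy Ky; pose b : T := exist _ y (conj Fy Ky).
  have [ba|ba|ab] := lt_tot y (sval a).
  + by apply: le_trans xmid _; exact: (midP a).2 b ba.
  + by rewrite ba.
  + by case: alast; exists b.
- exact: F'r.
- exact: (ub2_wb rF Fe).
- move=> y F'y; apply: contrapT => ny; apply: Knolb; exists y => // z Fz Kz.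
  by apply: contrapT => nyz; apply: ny; exists (exist _ z (conj Fz Kz)).
- by move=> a; case: (midP a).
- by move=> a b; case: (midP a) => _; apply.
Qed.

(** By [ub2_lower_bound], for E1 way below E2 way below E there is x above E1 and
below all common upper bounds of E2.  These x form a directed set: once a pair
between E and two given E2 is chosen, the new x is a common upper bound of both
E2, hence above both old elements. *)
Lemma pair_sup E c : ub2 E c -> exists t, isLub (range E) t.
Proof.
move=> Ec.
pose S := [set x | exists E1 E2, [/\ wb2 E1 E2, wb2 E2 E, ub2 E1 x &
  forall y, ub2 E2 y -> x <= y]].
have S_above (E1 : bool -> L) : wb2 E1 E -> exists2 x, S x & ub2 E1 x.
  move=> /wb2_interpolate[E2 E12 E2E].
  have [x E1x xE2] := ub2_lower_bound E12 (ub2_wb E2E Ec).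
  by exists x => //; exists E1, E2.
have dS : directed S.
  split.
    have /choice[E1 E1E] : forall s, exists u, way_below u (E s).
      by move=> s; exact: (L_cont.2 (E s)).1.1.
    by have [x Sx _] := S_above E1 E1E; exists x.
  move=> x y [E1 [E2 [_ E2E _ xE2]]] [F1 [F2 [_ F2E _ yF2]]].
  have /choice[G GP] : forall s, exists u, way_below u (E s) /\ (E2 s <= u /\ F2 s <= u).
    by move=> s; have [u] := way_below_upper L_cont (@E2E s) (@F2E s); exists u.
  have [z Sz Gz] := S_above G (fun s => (GP s).1); exists z => //.
  by split; [apply: xE2|apply: yF2] => s; apply: le_trans (Gz s);
    have [_ []] := GP s.
have [t [ubt lbt]] := L_cont.1 _ dS.
exists t; split=> [_ [s _ <-]|b bub].
  apply: (L_cont.2 (E s)).2.2 => u us.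
  (* complete u to a pair way below E with value u at s *)
  have /choice[E1 E1P] : forall s', exists v, way_below v (E s') /\ (s' = s -> v = u).
    move=> s'; have [->|/eqP ne] := eqVneq s' s; first by exists u.
    by have [v vs'] := (L_cont.2 (E s')).1.1; exists v; split.
  have [x Sx E1x] := S_above E1 (fun s' => (E1P s').1).
  by apply: le_trans (ubt _ Sx); rewrite -((E1P s).2 erefl).
apply: lbt => x [E1 [E2 [_ E2E _ xE2]]]; apply: xE2.
by apply: (ub2_wb E2E) => s; apply: bub; exists s.
Qed.

Lemma isbell_scott_cbc : conditionally_bounded_complete L.
Proof.
move=> A [a0 Aa0] [m Am].
pose S := [set x | exists2 l : seq L, (forall y, y \in l -> A y) & isLub [set` l] x].
have dS : directed S.
  split.
    exists a0, [:: a0]; first by move=> y; rewrite inE => /eqP ->.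
    split=> [y|b]; first by rewrite /= inE => /eqP ->.
    by apply; rewrite /= inE.
  move=> x y [l lA lx] [l' l'A l'y].
  have m_ub k z : (forall v, v \in k -> A v) -> isLub [set` k] z -> z <= m.
    by move=> kA kz; apply: kz.2 => v /kA; exact: Am.
  have [|t [ubt lbt]] := @pair_sup (fun s => if s then x else y) m.
    by case; [exact: m_ub lx|exact: m_ub l'y].
  have xt : x <= t by apply: ubt; exists true.
  have yt : y <= t by apply: ubt; exists false.
  exists t => //; exists (l ++ l').
    by move=> v; rewrite mem_cat => /orP[/lA|/l'A].
  split=> [v|b bub].
    rewrite /= mem_cat => /orP[vl|vl']; first by apply: le_trans xt; exact: lx.1.
    by apply: le_trans yt; exact: l'y.1.
  apply: lbt => _ [[] _ <-]; [apply: lx.2|apply: l'y.2] => v vl; apply: bub;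
    by rewrite /= mem_cat vl ?orbT.
have [t [ubt lbt]] := L_cont.1 _ dS; exists t; split=> [a Aa|b bub].
  apply: ubt; exists [:: a]; first by move=> y; rewrite inE => /eqP ->.
  split=> [y|b]; first by rewrite /= inE => /eqP ->.
  by apply; rewrite /= inE.
by apply: lbt => x [l lA lx]; apply: lx.2 => y /lA; exact: bub.
Qed.

End Order.

Theorem theorem1p2 (d : Order.disp_t) (L : porderType d)
    (L_neq0 : [set: L] !=set0) (L_cont : continuous_dcpo L) :
  (forall X : topologicalType, cover_compact [set: X] -> core_compact X ->
    @open (isbell X L) = @open (scott (contmap X L)) :> set (set (contmap X L)))
  <-> conditionally_bounded_complete L.
Proof.
split=> [coincide|L_cbc X X_compact X_cc].
  apply: isbell_scott_cbc => // I; apply: coincide.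
    exact: two_ended_compact.
  exact: two_ended_core_compact.
apply/seteqP; split=> W; first exact: isbell_open_scott_open L_cont.1 _.
exact: scott_open_isbell_open.
Qed.
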